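(* Let $h:\mathbb{R}^d\to\mathbb{R}^m$ and $g:\mathbb{R}^d\to\mathbb{R}^\ell$ be twice differentiable with Lipschitz-continuous derivatives and satisfy LICQ (defined in the context), and suppose that the feasible set $\Sigma=\{x\in\mathbb{R}^d : h(x)=0,\ g(x)\le 0\}$ is nonempty, bounded, and decomposes into finitely many connected components $\Sigma_1,\dots,\Sigma_C$. Let $p=d-m$, let $\mu_\Sigma$ be the $p$-dimensional Hausdorff measure on $\Sigma$, and suppose $\sigma_c:=\mu_\Sigma(\Sigma_c)>0$ for every $c$. Put $S=\mu_\Sigma(\Sigma)=\sum_c\sigma_c$ and $\alpha^*_c=\sigma_c/S$. Let $\tau\in(0,p)$ and let $\alpha_0=(\alpha^{(0)}_1,\dots,\alpha^{(0)}_C)$ be a probability vector with $\alpha^{(0)}_c>0$ for every $c$. Let $(\alpha_t)_{t\ge 0}$ be the mean-field iterates $\alpha_{t+1}=\Phi(\alpha_t)$, where $$(\Phi\alpha)_c=\frac{\alpha_c^{1-\beta}(\alpha_c^* )^{\beta}}{\sum_{j=1}^C\alpha_j^{1-\beta}(\alpha_j^* )^{\beta}},\qquad \beta=\frac{\tau}{p}.$$ Then for every $t\ge 0$, $$D_{\mathrm{KL}}^{\Sigma}(p_{\alpha_t}\,\|\,p_{\alpha^*})\le C_0\left(1-\frac{\tau}{p}\right)^{2t},\qquad C_0=\frac14\left(\max_c\log\frac{\alpha^{(0)}_c}{\alpha^*_c}-\min_c\log\frac{\alpha^{(0)}_c}{\alpha^*_c}\right)^2,$$ where $p_\alpha$ denotes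 the probability density on $\Sigma$ with respect to $\mu_\Sigma$ that has mass $\alpha_c$ on $\Sigma_c$ and is uniform within each $\Sigma_c$. In particular, $p_{\alpha_t}\to u_\Sigma$ in KL divergence as $t\to\infty$, i.e. $D_{\mathrm{KL}}^{\Sigma}(p_{\alpha_t}\,\|\,u_\Sigma)\to 0$, where $u_\Sigma=1/S$ is the uniform density on $\Sigma$.
   Context: LICQ (linear independence constraint qualification): for each $x\in\Sigma$, the family of gradients of active constraints $\{\nabla h_j(x)\}_{j=1}^m\cup\{\nabla g_i(x): g_i(x)=0\}$ is linearly independent. Under LICQ, $\Sigma$ is a manifold with corners of intrinsic dimension $p=d-m$. Component-weight density: for a probability vector $\alpha=(\alpha_1,\dots,\alpha_C)$, $p_\alpha(x)=\alpha_{c}/\sigma_{c}$ for $x\in\Sigma_c$. Thus $p_{\alpha^*}=u_\Sigma$. KL divergence on $\Sigma$: $D_{\mathrm{KL}}^\Sigma(\rho\,\|\,q)=\int_\Sigma\rho\log(\rho/q)\,d\mu_\Sigma$ for probability densities $\rho,q$ with respect to $\mu_\Sigma$. Origin of the map $\Phi$: the algorithm (MASEM) runs $N$ particles on $\Sigma$. In each iteration it resamples the particles with weights proportional to $\varepsilon_{i,k}^{\tau}$, where $\varepsilon_{i,k}$ is the distance of particle $i$ to its $k$-th nearest neighbour, and then applies a rejuvenation kernel. The mixing-rejuvenation assumption is that this kernel leaves each uniform law $u_c=\sigma_c^{-1}\mathbf{1}_{\Sigma_c}$ invariant and that, after its application, the particles in $\Sigma_c$ are i.i.d. draws from $u_c$.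 The mean-field iterates are the $N\to\infty$ limit of the fractions of particles in each component, under this assumption and with any neighbour schedule $k=k_N$ satisfying $k_N\to\infty$ and $k_N/N\to0$. This limit is by definition the deterministic recursion $\alpha_{t+1}=\Phi(\alpha_t)$. The vector $\alpha_0$ consists of the component weights after the algorithm's initial projection onto $\Sigma$. *)

(* Defs.v *)
From HB Require Import structures.
From mathcomp Require Import all_boot all_order all_algebra.
From mathcomp Require Import all_classical all_reals all_analysis.

Set Implicit Arguments.
Unset Strict Implicit.
Unset Printing Implicit Defensive.

Import Order.TTheory GRing.Theory Num.Theory.
Import numFieldNormedType.Exports.

Local Open Scope classical_set_scope.
Local Open Scope ring_scope.

Section cover_content.
Context (R : realType) (T : Type).
Variables (K : set (set T)) (w : set T -> \bar R).
Local Open Scope ereal_scope.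

Definition admissible_cover (A : set T) : set ((set T)^nat) :=
  [set U | (forall k, K (U k)) /\ A `<=` \bigcup_k U k].

Definition cover_content (A : set T) : \bar R :=
  ereal_inf [set \sum_(k <oo) w (U k) | U in admissible_cover A].

Hypotheses (K0 : K set0) (w0 : w set0 = 0) (w_ge0 : forall U, 0 <= w U).

Lemma le_cover_content : {homo cover_content : A B / A `<=` B >-> A <= B}.
Proof.
move=> A B AB; apply/ereal_inf_le_tmp => x [U [KU BU] <-].
by exists U => //; split => //; exact: subset_trans BU.
Qed.

Lemma cover_content_ge0 A : 0 <= cover_content A.
Proof. by apply: le_ereal_inf_tmp => x [U _ <-]; exact: nneseries_ge0. Qed.

Lemma cover_content0 : cover_content set0 = 0.
Proof.
apply/eqP; rewrite eq_le cover_content_ge0 andbT.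
apply: ereal_inf_lbound; exists (fun=> set0); first by split.
exact: eseries0.
Qed.

Lemma cover_content_sigma_subadditive : sigma_subadditive cover_content.
Proof.
move=> A; have [[i ioo]|] := pselect (exists i, cover_content (A i) = +oo).
  rewrite (eseries_pinfty _ _ ioo) ?leey// => n _.
  by rewrite -ltNye (lt_le_trans _ (cover_content_ge0 _)).
rewrite -forallNE => Aoo.
suff add2e (e : {posnum R}) : cover_content (\bigcup_n A n) <=
    \sum_(i <oo) cover_content (A i) + e%:num%:E.
  by apply/lee_addgt0Pr => _/posnumP[].
rewrite (le_trans _ (epsilon_trick _ _ _))//; last first.
  by move=> n; exact: cover_content_ge0.
pose P n (B : (set T)^nat) := admissible_cover (A n) B /\
  \sum_(k <oo) w (B k) <= cover_content (A n) + (e%:num / (2 ^ n.+1)%:R)%:E.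
have [G PG] : {G : ((set T)^nat)^nat & forall n, P n (G n)}.
  apply: (@choice _ _ P) => n; rewrite /P /cover_content.
  set S := (X in ereal_inf X); move infS : (ereal_inf S) => iS.
  case: iS infS => [r Sr|Soo|Soo].
  - have en1 : (0 < e%:num / (2 ^ n.+1)%:R)%R by [].
    have /(lb_ereal_inf_adherent en1) : ereal_inf S \is a fin_num by rewrite Sr.
    move=> [x [B [mB AnB muBx] xS]].
    by exists B; split => //; rewrite muBx -Sr; exact/ltW.
  - by have := Aoo n; rewrite /cover_content Soo.
  - suff : lbound S 0 by move/le_ereal_inf_tmp; rewrite Soo.
    by move=> /= _ [B [mB AnB] <-]; exact: nneseries_ge0.
have wG_ge0 x : 0 <= (w \o uncurry G) x by exact: w_ge0.
apply: (@le_trans _ _ (\esum_(i in setT) (w \o uncurry G) i)).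
  rewrite /cover_content; apply: ereal_inf_lbound => /=.
  have /card_esym/ppcard_eqP[f] := card_nat2.
  exists (uncurry G \o f).
    split => [i|]; first by rewrite /= /uncurry; case: (f i) => a b /=;
      exact: (PG a).1.1.
    apply: (@subset_trans _  (\bigcup_n \bigcup_k G n k)) => [t [i _]|].
      by move=> /((PG i).1.2) -[j _ ?]; exists i => //; exists j.
    move=> t [i _ [j _ Bijt]]; exists (f^-1%FUN (i, j)) => //=.
    by rewrite invK ?inE.
  rewrite -(esum_pred_image (w \o uncurry G) _ xpredT) ?[fun=> _]set_true//.
  by rewrite image_eq.
rewrite (_ : esum _ _ = \sum_(i <oo) \sum_(j <oo ) w (G i j)); last first.
  pose J : nat -> set (nat * nat) := fun i => [set (i, j) | j in setT].
  rewrite (_ : setT = \bigcup_k J k); last first.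
    by rewrite predeqE => -[a b]; split => // _; exists a => //; exists b.
  rewrite esum_bigcupT /=; last 2 first.
    - apply/trivIsetP => i j _ _ ij.
      rewrite predeqE => -[n m] /=; split => //= -[] [_] _ [<-{n} _].
      by move=> [m' _] [] /esym/eqP; rewrite (negbTE ij).
    - by move=> /= [n m]; exact: w_ge0.
  rewrite -(image_id [set: nat]) -fun_true esum_pred_image//; last first.
    by move=> n _; exact: esum_ge0.
  apply: eq_eseriesr => /= j _.
  rewrite -(esum_pred_image (w \o uncurry G) (pair j) predT)//=; last first.
    by move=> ? ? _ _; exact: (@can_inj _ _ _ snd).
  by congr esum; rewrite predeqE => -[a b]; split; move=> [i _ <-]; exists i.
apply: lee_lim.
- apply: is_cvg_nneseries => n *.
  by apply: nneseries_ge0 => k *; exact: (wG_ge0 (n, k)).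
- by apply: is_cvg_nneseries => n *; apply: adde_ge0 => //;
    exact: cover_content_ge0.
- by near=> n; apply: lee_sum => i _; exact: (PG i).2.
Unshelve. all: by end_near. Qed.

End cover_content.

Section hausdorff.
Context (R : realType) (d : nat).

(* The library norm on 'rV[R]_d is the sup norm, hence the explicit Euclidean
   norm: Hausdorff measures depend on the metric. *)
Definition enorm (x : 'rV[R]_d) : R := Num.sqrt (\sum_i x 0 i ^+ 2).

Local Open Scope ereal_scope.

(* [-oo] on the empty set *)
Definition ediam (U : set 'rV[R]_d) : \bar R :=
  ereal_sup [set (enorm (x - y))%:E | x in U & y in U].

(* Lebesgue measure of the Euclidean unit ball of R^n, through the recursion
   v_(n+2) = 2 pi / (n+2) * v_n *)
Fixpoint unit_ball_volume (n : nat) : R :=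
  match n with
  | 0 => 1
  | 1 => 2
  | k.+2 => 2 * pi / k.+2%:R * unit_ball_volume k
  end%R.

Definition hausdorff_gauge (p : nat) (U : set 'rV[R]_d) : \bar R :=
  if U == set0 then 0
  else (unit_ball_volume p / 2 ^+ p)%:E * (ediam U) ^+ p.

Definition hausdorff_content (p : nat) (delta : R) :
    set 'rV[R]_d -> \bar R :=
  cover_content [set U | ediam U <= delta%:E] (hausdorff_gauge p).

Definition hausdorff (p : nat) (A : set 'rV[R]_d) : \bar R :=
  ereal_sup [set hausdorff_content p delta A | delta in [set e : R | (0 < e)%R]].

Lemma ediam0 : ediam set0 = -oo.
Proof.
rewrite /ediam (_ : [set _ | _ in _ & _ in _] = set0) ?ereal_sup0//.
by apply/seteqP; split => [x [? []]|].
Qed.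

Lemma unit_ball_volume_gt0 n : (0 < unit_ball_volume n)%R.
Proof.
suff : (0 < unit_ball_volume n)%R /\ (0 < unit_ball_volume n.+1)%R by case.
elim: n => [|n [IH1 IH2]]; split => //.
by rewrite /= mulr_gt0// divr_gt0// mulr_gt0// pi_gt0.
Qed.

Lemma hausdorff_gauge0 p : hausdorff_gauge p set0 = 0.
Proof. by rewrite /hausdorff_gauge eqxx. Qed.

Lemma hausdorff_gauge_ge0 p U : 0 <= hausdorff_gauge p U.
Proof.
rewrite /hausdorff_gauge; case: ifPn => // /set0P[x Ux].
rewrite mule_ge0//.
  by rewrite lee_fin divr_ge0 ?exprn_ge0// ltW// unit_ball_volume_gt0.
apply: expe_ge0; apply: (@le_trans _ _ (enorm (x - x))%:E).
  by rewrite lee_fin sqrtr_ge0.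
by apply: ereal_sup_ubound; exists x => //; exists x.
Qed.

Lemma hausdorff0 p : hausdorff p set0 = 0.
Proof.
have c0 e : hausdorff_content p e set0 = 0.
  apply: cover_content0; [by rewrite /= ediam0 leNye|exact: hausdorff_gauge0|].
  exact: hausdorff_gauge_ge0.
apply/eqP; rewrite eq_le; apply/andP; split.
  by apply: ge_ereal_sup => _ [e _ <-]; rewrite c0.
by apply: ereal_sup_ubound; exists 1%R => //=; rewrite c0.
Qed.

Lemma hausdorff_ge0 p A : 0 <= hausdorff p A.
Proof.
apply: (@le_trans _ _ (hausdorff_content p 1 A)).
  by apply: cover_content_ge0; exact: hausdorff_gauge_ge0.
by apply: ereal_sup_ubound; exists 1%R => /=.
Qed.

Lemma le_hausdorff p : {homo hausdorff p : A B / A `<=` B >-> A <= B}.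
Proof.
move=> A B AB; apply: ge_ereal_sup => _ [e e0 <-].
apply: (@le_trans _ _ (hausdorff_content p e B)); first exact: le_cover_content.
by apply: ereal_sup_ubound; exists e.
Qed.

Lemma hausdorff_sigma_subadditive p : sigma_subadditive (hausdorff p).
Proof.
move=> F; apply: ge_ereal_sup => _ [e e0 <-].
apply: (@le_trans _ _ (\sum_(i <oo) hausdorff_content p e (F i))).
  apply: cover_content_sigma_subadditive; first exact: hausdorff_gauge_ge0.
apply: lee_nneseries => [i _ _|i _].
  by apply: cover_content_ge0; exact: hausdorff_gauge_ge0.
by apply: ereal_sup_ubound; exists e.
Qed.

HB.instance Definition _ (p : nat) := isOuterMeasure.Build R 'rV[R]_d
  (hausdorff p) (hausdorff0 p) (@hausdorff_ge0 p) (@le_hausdorff p)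
  (@hausdorff_sigma_subadditive p).

Definition hausdorff_outer (p : nat) : {outer_measure set 'rV[R]_d -> \bar R} :=
  hausdorff p.

(* on the Caratheodory-measurable sets of the outer measure *)
Definition hausdorff_measure (p : nat) :
    {measure set (caratheodory_type (hausdorff_outer p)) -> \bar R} :=
  hausdorff_outer p : set (caratheodory_type (hausdorff_outer p)) -> \bar R.

End hausdorff.

Section constraints.
Context (R : realType) (d m l : nat).

(* [lipschitz] is with respect to the entrywise sup norms; since only the
   existence of a constant is asserted, any other norms would do. *)
Definition twice_diff_lip (n : nat) (f : 'rV[R]_d -> 'rV[R]_n) : Prop :=
  [/\ forall x, differentiable f x,
      forall x, differentiable (jacobian f) x &
      lipschitz (jacobian f)].

Definition gradient (f : 'rV[R]_d -> R) (x : 'rV[R]_d) : 'rV[R]_d :=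
  \row_i 'D_(delta_mx 0 i) f x.

Variables (h : 'rV[R]_d -> 'rV[R]_m) (g : 'rV[R]_d -> 'rV[R]_l).

Definition feasible : set 'rV[R]_d :=
  [set x | h x = 0 /\ forall i, g x 0 i <= 0].

Definition active_gradients (x : 'rV[R]_d) : seq 'rV[R]_d :=
  [seq gradient (fun y => h y 0 j) x | j <- enum 'I_m] ++
  [seq gradient (fun y => g y 0 i) x | i <- enum 'I_l & g x 0 i == 0].

(* [free] is linear independence of a family: a repeated gradient violates it. *)
Definition LICQ : Prop := forall x, feasible x -> free (active_gradients x).

End constraints.

Definition enumerates_components (T : topologicalType) (A : set T) (C : nat)
    (Ac : 'I_C -> set T) : Prop :=
  injective Ac /\ range Ac = connected_component A @` A.

Section densities.
Context (R : realType).

(* a log (a / b), with 0 log (0 / b) = 0 and a log (a / 0) = +oo for a <> 0 *)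
Definition kl_term (a b : R) : \bar R :=
  if a == 0 then 0%E else if b == 0 then +oo%E else (a * ln (a / b))%:E.

Definition KL (disp : measure_display) (T : measurableType disp)
    (mu : {measure set T -> \bar R}) (D : set T) (rho q : T -> R) : \bar R :=
  (\int[mu]_(x in D) kl_term (rho x) (q x))%E.

Definition component_density (T : Type) (C : nat) (Ac : 'I_C -> set T)
    (sigma alpha : 'I_C -> R) (x : T) : R :=
  \sum_(c < C) alpha c / sigma c * \1_(Ac c) x.

Definition uniform_density (T : Type) (A : set T) (S : R) (x : T) : R :=
  S^-1 * \1_A x.

Definition Phi (C : nat) (beta : R) (astar alpha : 'I_C -> R) (c : 'I_C) : R :=
  alpha c `^ (1 - beta) * astar c `^ beta /
  \sum_(j < C) alpha j `^ (1 - beta) * astar j `^ beta.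

Definition mean_field (C : nat) (beta : R) (astar alpha0 : 'I_C -> R)
    (t : nat) : 'I_C -> R :=
  iter t (Phi beta astar) alpha0.

(* [sup] and [inf] are a maximum and a minimum here, as 'I_C is finite and
   non-empty (C = 0 only if there are no components) *)
Definition log_ratio_constant (C : nat) (astar alpha0 : 'I_C -> R) : R :=
  let r := range (fun c => ln (alpha0 c / astar c)) in
  4^-1 * (sup r - inf r) ^+ 2.

End densities.

(* Main.v *)
(* In the log-ratio coordinates ln (alpha_c / astar_c) the map Phi multiplies by
   1 - beta and then translates, so the oscillation of the log-ratios decays like
   (1 - beta)^t.  The divergence is at most a quarter of the squared oscillation:
   it is bounded by its symmetrisation sum_c (alpha_c - astar_c) x_c, where the
   log-ratios x_c may be centred, and the total variation is bounded through the
   chord of |y - 1| and tanh u <= u.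

   Identifying the divergence of the densities with the finite one requires
   mu(Sigma) to be finite and the components to be measurable.  Closed sets are
   Caratheodory measurable because the Hausdorff outer measure is additive on
   separated sets.  For finiteness, LICQ gives a linear map P into R^(d-m) that
   is injective on the kernel of Dh(x); by the mean value theorem P is then
   injective with Lipschitz inverse on {h = 0} near x (no implicit function
   theorem is needed, as surjectivity plays no role), and the inverse image of a
   fine grid has bounded total gauge. *)

Require Import Defs.
From mathcomp Require Import all_boot all_order all_algebra finmap.
From mathcomp Require Import all_classical all_reals all_analysis.
From mathcomp Require Import measurable_realfun.
From mathcomp Require Import ring lra zify.

Import Order.TTheory GRing.Theory Num.Theory.
Import numFieldNormedType.Exports.

Local Open Scope classical_set_scope.
Local Open Scope ring_scope.

(** * The Hausdorff outer measure is metric *)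

(* The rings [D n.+1 `\` D n] with indices two apart are separated, so their
   measures telescope in steps of two and [mu (X `&` D n)] tends to
   [mu (X `\` A)]. *)
Lemma caratheodory_exhaustion (R : realType) (T : Type)
    (mu : {outer_measure set T -> \bar R}) (A : set T) (D : (set T)^nat) :
  (forall X n, mu (X `&` A) + mu (X `&` D n) <= mu X)%E ->
  (forall X n, mu (X `&` D n) + mu (X `&` ~` D n.+1) <= mu X)%E ->
  (forall n, D n `<=` D n.+1) -> ~` A `<=` \bigcup_n D n ->
  mu.-caratheodory A.
Proof.
move=> AD DD Dincr AcD; apply: le_caratheodory_measurable => X.
have [->|Xfin] := eqVneq (mu X) +oo%E; first exact: leey.
have fin Y : Y `<=` X -> mu Y = (fine (mu Y))%:E.
  move=> YX; rewrite fineK// ge0_fin_numE ?outer_measure_ge0//.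
  by rewrite (le_lt_trans (le_outer_measure mu _ _ YX))// ltey.
have Dhomo i j : (i <= j)%N -> D i `<=` D j.
  move=> ij; rewrite -(subnKC ij); elim: (j - i)%N => [|k IH].
    by rewrite addn0.
  by rewrite addnS; exact: subset_trans (Dincr _).
pose a n := fine (mu (X `&` D n)).
pose r n := fine (mu (X `&` (D n.+1 `\` D n))).
have a3 n : a n.+1 + r n.+2 <= a n.+3.
  rewrite -lee_fin EFinD /a /r -!fin; do ?exact: subIsetl.
  apply: le_trans (DD (X `&` D n.+3) n.+1); apply: leeD.
    apply: le_outer_measure => x [Xx Dx]; split=> //; split=> //.
    by apply: (Dhomo _ _ _ _ Dx); lia.
  by apply: le_outer_measure => x [Xx [Dx nDx]].
have tele N M : \sum_(0 <= k < M) r (N + k).+2 <=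
    a (N + M).+1 + a (N + M).+2 - a N.+1 - a N.+2.
  elim: M => [|M IH]; first by rewrite big_geq// addn0; lra.
  by rewrite big_nat_recr//= addnS; have := a3 (N + M)%N; lra.
have a_incr i j : (i <= j)%N -> a i <= a j.
  move=> ij; rewrite -lee_fin /a -!fin; do ?exact: subIsetl.
  by apply: le_outer_measure => x [Xx Dx]; split=> //; apply: (Dhomo _ _ _ _ Dx).
have a_ub n : a n <= fine (mu X) - fine (mu (X `&` A)).
  rewrite lerBrDr addrC -lee_fin EFinD /a -!fin//; do ?exact: subIsetl.
have asup : has_sup (range a).
  split; first by exists (a 0%N), 0%N.
  by exists (fine (mu X) - fine (mu (X `&` A))) => _ [n _ <-].
have a_sup n : a n <= sup (range a) by apply: sup_upper_bound => //; exists n.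
have Lub : sup (range a) <= fine (mu X) - fine (mu (X `&` A)).
  by apply: ge_sup => [|_ [n _ <-]//]; case: asup.
rewrite (fin (X `&` A)); last exact: subIsetl.
rewrite (fin X)// addeC -leeBrDr// -EFinB.
apply: (@le_trans _ _ (sup (range a))%:E); last by rewrite lee_fin.
apply/lee_addgt0Pr => e e0.
have [_ [N _ <-] LN] := sup_adherent e0 asup.
apply: (@le_trans _ _ (mu ((X `&` D N.+2) `|`
  \bigcup_k (X `&` (D (N + k).+3 `\` D (N + k).+2))))).
  (* The least [k] with [x] in [D k] places [x] either in [D N.+2] or in the ring that ends at
     [D k]. *)
  apply: le_outer_measure => x [Xx /AcD[n _ Dx]].
  have exD : exists n, `[< D n x >] by exists n; apply/asboolP.
  case: (ex_minnP exD) => k /asboolP Dk kmin.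
  have [kN|] := leqP k N.+2; first by left; split=> //; apply: (Dhomo _ _ _ _ Dk).
  case: k Dk kmin => // k Dk kmin Nk; right; exists (k - N.+2)%N => //.
  have -> : (N + (k - N.+2)).+2 = k by lia.
  split=> //; split=> // Dkx.
  by have := kmin k; rewrite ltnn => /(_ (asboolT Dkx)).
apply: le_trans (outer_measureU2 _ _ _) _.
(* In the telescoped tail both upper terms are replaced by the supremum. As [a] increases and [a N]
   is within [e] of it, the total is at most the supremum plus [e]. *)
apply: (@le_trans _ _ ((a N.+2)%:E + (2 * sup (range a) - a N.+1 - a N.+2)%:E)%E).
  apply: leeD; first by rewrite /a -fin//; exact: subIsetl.
  apply: le_trans (outer_measure_sigma_subadditive _ _) _.
  apply: lime_le; first by apply: is_cvg_nneseries => *; exact: outer_measure_ge0.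
  apply: nearW => M.
  rewrite (eq_bigr (fun k => (r (N + k).+2)%:E)); last first.
    by move=> k _; rewrite /r -fin//; exact: subIsetl.
  rewrite sumEFin lee_fin (le_trans (tele N M))//.
  by have := a_sup (N + M).+1; have := a_sup (N + M).+2; lra.
rewrite -!EFinD lee_fin.
by have := a_incr N N.+1 (leqnSn _); lra.
Qed.

(** * Sup norm against Euclidean norm on row vectors *)

Section row_norms.
Context (R : realType) (d : nat).
Implicit Types x y : 'rV[R]_d.

Lemma ler_norm_coord x i : `|x 0 i| <= `|x|.
Proof.
rewrite [leRHS]/Num.norm/= mx_normrE.
by apply/bigmax_geP; right; exists (0, i).
Qed.

Lemma norm_rV_le x (r : R) : 0 <= r -> (forall i, `|x 0 i| <= r) -> `|x| <= r.
Proof.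
move=> r0 xr; rewrite [leLHS]/Num.norm/= mx_normrE.
by apply/bigmax_leP; split=> // -[i j] _ /=; rewrite ord1.
Qed.

Lemma norm_le_enorm x : `|x| <= enorm x.
Proof.
apply: norm_rV_le => [|i]; first exact: sqrtr_ge0.
rewrite -sqrtr_sqr ler_sqrt ?sumr_ge0// => [|j _]; last exact: sqr_ge0.
by rewrite (bigD1 i)//= lerDl sumr_ge0// => j _; exact: sqr_ge0.
Qed.

Lemma enorm_le_norm x : enorm x <= Num.sqrt d%:R * `|x|.
Proof.
rewrite -[in leRHS](normr_id x) -sqrtr_sqr -sqrtrM ?ler0n// ler_sqrt.
  have -> : d%:R * `|x| ^+ 2 = \sum_(i < d) `|x| ^+ 2.
    by rewrite sumr_const card_ord mulr_natl.
  apply: ler_sum => i _; rewrite -real_normK ?num_real//.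
  by rewrite lerXn2r ?nnegrE// ler_norm_coord.
by rewrite mulr_ge0 ?sqr_ge0.
Qed.

End row_norms.

Section hausdorff_metric.
Context (R : realType) (d p : nat).
Implicit Types A B U : set 'rV[R]_d.

Lemma le_ediam U x y : U x -> U y -> ((enorm (x - y))%:E <= ediam U)%E.
Proof. by move=> Ux Uy; apply: ereal_sup_ubound; exists x => //; exists y. Qed.

(** A set of diameter at most [e < delta] cannot meet both [A] and [B], so a cover of the union
    splits into a cover of each. The separation in the sup norm passes to the larger Euclidean norm
    that defines the diameter. *)
Lemma hausdorff_content_separated A B (delta e : R) : e < delta ->
  (forall x y, A x -> B y -> delta <= `|x - y|) ->
  (hausdorff_content p e A + hausdorff_content p e B <=
   hausdorff_content p e (A `|` B))%E.
Proof.
move=> edelta sep; apply: le_ereal_inf_tmp => _ [U [Ue ABU] <-].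
(* Sets that miss [E] become empty and cost nothing, so at each index at most one of [V A k] and
   [V B k] contributes. *)
pose V E k := if pselect (U k `&` E !=set0) then U k else set0.
have VK E k : (ediam (V E k) <= e%:E)%E.
  by rewrite /V; case: pselect => ?; [exact: Ue|rewrite ediam0 leNye].
have Vcover E : E `<=` A `|` B -> E `<=` \bigcup_k V E k.
  move=> EAB x Ex; have [k _ Ux] := ABU x (EAB x Ex); exists k => //.
  by rewrite /V; case: pselect => // -[]; exists x.
apply: (@le_trans _ _ (\sum_(k <oo) hausdorff_gauge p (V A k) +
                       \sum_(k <oo) hausdorff_gauge p (V B k))%E).
  apply: leeD; apply: ereal_inf_lbound.
    by exists (V A) => //; split; [exact: VK|apply: Vcover; exact: subsetUl].
  by exists (V B) => //; split; [exact: VK|apply: Vcover; exact: subsetUr].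
rewrite -nneseriesD; do ?by move=> *; exact: hausdorff_gauge_ge0.
apply: lee_nneseries => [k _ _|k _].
  by rewrite adde_ge0// hausdorff_gauge_ge0.
rewrite /V; case: pselect => [[x [Ux Ax]]|?]; case: pselect => [[y [Uy By]]|?];
  rewrite ?hausdorff_gauge0 ?adde0 ?add0e ?hausdorff_gauge_ge0//.
have := le_trans (le_ediam _ _ _ Ux Uy) (Ue k); rewrite lee_fin => xye.
have := le_trans (sep _ _ Ax By) (norm_le_enorm _ _ (x - y)).
by move=> /le_trans/(_ xye); rewrite leNgt edelta.
Qed.

Lemma hausdorff_content_nonincreasing A (e e' : R) : e <= e' ->
  (hausdorff_content p e' A <= hausdorff_content p e A)%E.
Proof.
move=> ee'; apply: ereal_inf_le_tmp => w [U [Ue AU] <-]; exists U => //.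
by split=> // k; exact: le_trans (Ue k) _.
Qed.

(** Contents grow as the mesh shrinks, so two independent meshes may be replaced by a common one
    below [delta]. The two suprema are then taken one after the other. *)
Lemma hausdorff_separated A B (delta : R) : 0 < delta ->
  (forall x y, A x -> B y -> delta <= `|x - y|) ->
  (hausdorff p A + hausdorff p B <= hausdorff p (A `|` B))%E.
Proof.
move=> delta0 sep.
have [->|ABfin] := eqVneq (hausdorff p (A `|` B)) +oo%E; first exact: leey.
have fin E : E `<=` A `|` B -> hausdorff p E \is a fin_num.
  move=> EAB; rewrite ge0_fin_numE ?hausdorff_ge0//.
  by rewrite (le_lt_trans (le_hausdorff _ EAB))// ltey.
have key e1 e2 : 0 < e1 -> 0 < e2 ->
    (hausdorff_content p e1 A + hausdorff_content p e2 B <=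
     hausdorff p (A `|` B))%E.
  move=> e10 e20; pose e := Num.min (delta / 2) (Num.min e1 e2).
  have e0 : 0 < e by rewrite !lt_min e10 e20 divr_gt0.
  have edelta : e < delta by rewrite /e gt_min; apply/orP; left; lra.
  apply: (@le_trans _ _ (hausdorff_content p e A + hausdorff_content p e B)%E).
    by apply: leeD; apply: hausdorff_content_nonincreasing;
      rewrite /e !ge_min lexx ?orbT.
  apply: le_trans (hausdorff_content_separated _ _ _ _ edelta sep) _.
  by apply: ereal_sup_ubound; exists e.
have finc E e : E `<=` A `|` B -> 0 < e -> hausdorff_content p e E \is a fin_num.
  move=> EAB e0; rewrite ge0_fin_numE.
    apply: le_lt_trans (_ : hausdorff p E < +oo)%E.
      by apply: ereal_sup_ubound; exists e.
    by rewrite -ge0_fin_numE ?hausdorff_ge0// fin.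
  by apply: cover_content_ge0; exact: hausdorff_gauge_ge0.
have [AAB BAB] : A `<=` A `|` B /\ B `<=` A `|` B.
  by split; [exact: subsetUl|exact: subsetUr].
rewrite -leeBrDr; last exact: fin.
apply: ge_ereal_sup => _ [e1 e10 <-].
rewrite leeBrDr; last exact: fin.
rewrite -leeBrDl; last exact: finc.
apply: ge_ereal_sup => _ [e2 e20 <-].
by rewrite leeBrDl; [exact: key|exact: finc].
Qed.

Lemma closed_hausdorff_measurable A : closed A ->
  (hausdorff_outer R d p).-caratheodory A.
Proof.
move=> cA.
(* Points at distance at least [1 / (n + 1)] from [A]; closedness makes them exhaust the complement.
   By the triangle inequality, [D n] and the complement of [D n.+1] are [1 / (n + 1) - 1 / (n + 2)]
   apart. *)
pose D n := [set x : 'rV[R]_d | forall y, A y -> n.+1%:R^-1 <= `|x - y|].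
have inv0 n : 0 < (n.+1%:R : R)^-1 by rewrite invr_gt0.
have inv_decr n : (n.+2%:R : R)^-1 < n.+1%:R^-1.
  by rewrite ltf_pV2 ?posrE// ltr_nat.
apply: (@caratheodory_exhaustion _ _ _ _ D).
- move=> X n; apply: le_trans (hausdorff_separated _ _ _ (inv0 n) _) _.
    by move=> x y [_ Ax] [_ Dy]; rewrite distrC; exact: Dy.
  by apply: le_hausdorff; rewrite -setIUr; exact: subIsetl.
- move=> X n.
  apply: le_trans (hausdorff_separated _ _ (n.+1%:R^-1 - n.+2%:R^-1) _ _) _.
  + by rewrite subr_gt0.
  + move=> x z [_ Dx] [_ /existsNP[y /not_implyP[Ay /negP]]].
    rewrite -ltNge => zy; rewrite lerBlDr (le_trans (Dx _ Ay))//.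
    by rewrite (le_trans (ler_distD z _ _))// lerD2l ltW.
  by apply: le_hausdorff; rewrite -setIUr; exact: subIsetl.
- by move=> n x Dx y Ay; rewrite (le_trans (ltW (inv_decr n)))// Dx.
- move=> x nAx.
  have /nbhs_ballP[e /= e0 exA] : nbhs x (~` A).
    by apply: open_nbhs_nbhs; split=> //; exact: closed_openC.
  have [n ne] : exists n, (n.+1%:R : R)^-1 < e.
    by have [n] := ltr_add_invr e0; rewrite add0r; exists n.
  exists n => // y Ay; rewrite leNgt; apply/negP => xyn.
  by apply: (exA y) => //; rewrite -ball_normE/= (lt_trans xyn).
Qed.

End hausdorff_metric.

(** * Finiteness of the Hausdorff measure of the feasible set *)

Lemma cover_content_le_sum (R : realType) (T : Type) (K : set (set T))
    (w : set T -> \bar R) (I : finType) (U : I -> set T) (A : set T) :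
  K set0 -> w set0 = 0%E -> (forall V, 0 <= w V)%E ->
  (forall i, K (U i)) -> A `<=` \bigcup_i U i ->
  (cover_content K w A <= \sum_i w (U i))%E.
Proof.
move=> K0 w0 w_ge0 KU AU; pose s := [seq U i | i <- enum I].
(* Past the end of the list [nth] returns [set0], which is admissible and has weight zero. *)
apply: ereal_inf_lbound; exists (nth set0 s).
  split=> [k|x /AU[i _ Uix]].
    have [ks|sk] := ltnP k (size s); last by rewrite nth_default.
    by have /mapP[i _ ->] := mem_nth set0 ks; exact: KU.
  exists (index i (enum I)) => //.
  by rewrite (nth_map i) ?index_mem ?mem_enum// nth_index ?mem_enum.
rewrite (nneseries_split 0 (size s))// add0n [X in (_ + X)%E]eseries0 ?adde0.
  by rewrite -(big_nth set0 xpredT) big_map big_enum.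
by move=> k sk _; rewrite nth_default.
Qed.

Lemma hausdorff_gauge_le (R : realType) (d p : nat) (U : set 'rV[R]_d) (r : R) :
  0 <= r -> (forall x y, U x -> U y -> enorm (x - y) <= r) ->
  (hausdorff_gauge p U <= (unit_ball_volume R p / 2 ^+ p * r ^+ p)%:E)%E.
Proof.
have v0 : 0 <= unit_ball_volume R p / 2 ^+ p.
  by rewrite divr_ge0 ?exprn_ge0// ltW// unit_ball_volume_gt0.
move=> r0 Ur; rewrite /hausdorff_gauge; case: ifPn => [_|/set0P[x Ux]].
  by rewrite lee_fin mulr_ge0 ?exprn_ge0.
have dr : (ediam U <= r%:E)%E.
  by apply: ge_ereal_sup => _ [y Uy [z Uz <-]]; rewrite lee_fin; exact: Ur.
have d0 : (0 <= ediam U)%E.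
  by apply: le_trans (le_ediam _ _ _ _ _ Ux Ux); rewrite lee_fin sqrtr_ge0.
rewrite [leRHS]EFinM; apply: lee_wpmul2l => //; rewrite EFin_expe; elim: (p) => [//|n IH].
by rewrite !expeS lee_pmul// expe_ge0.
Qed.

(* Cut the image of [A] in [-M, M]^p into a grid of cells of side [O(1/n)]: the
   [n^p] preimages have diameter [O(1/n)], so their gauges sum to [O(1)]. *)
Lemma hausdorff_lt_pinfty (R : realType) (d p : nat) (A : set 'rV[R]_d)
    (f : 'I_p -> 'rV[R]_d -> R) (M K : R) : 0 < M -> 0 <= K ->
  (forall x i, A x -> `|f i x| <= M) ->
  (forall x y (r : R), 0 <= r -> A x -> A y -> (forall i, `|f i x - f i y| <= r) ->
     `|x - y| <= K * r) ->
  (hausdorff p A < +oo)%E.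
Proof.
(* Cells of side [3 * M / N] have preimages of sup-norm diameter at most [K * (3 * M / N)], hence of
   Euclidean diameter at most [G / N]. *)
move=> M0 K0 fM fK; pose G := Num.sqrt d%:R * (K * (3 * M)).
have G0 : 0 <= G by rewrite !mulr_ge0// ?sqrtr_ge0// ltW.
pose v := unit_ball_volume R p / 2 ^+ p.
apply: le_lt_trans (ltry (v * G ^+ p)).
apply: ge_ereal_sup => _ [e e0 <-].
have [n Gn] : exists n, G / n.+1%:R < e.
  have G1 : 0 < G + 1 by lra.
  have [n] := ltr_add_invr (divr_gt0 e0 G1); rewrite add0r ltr_pdivlMr// => ne.
  exists n; apply: le_lt_trans ne; rewrite mulrC ler_wpM2l//; lra.
set N := n.+1 in Gn; have N0 : 0 < (N%:R : R) by rewrite ltr0n.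
(* Dividing by [3 * M] instead of [2 * M] keeps the quotient at most 2/3, so the index stays below
   [N] even where [f i x = M]. *)
pose cell i x := Num.truncn ((f i x + M) / (3 * M) * N%:R).
have cell_ge0 i x : A x -> 0 <= (f i x + M) / (3 * M) * N%:R.
  move=> /fM-/(_ i); rewrite ler_norml => /andP[fM0 _].
  by rewrite mulr_ge0 ?ler0n// divr_ge0 ?mulr_ge0 ?ler0n// ?(ltW M0)//; lra.
have cell_lt i x : A x -> (cell i x < N)%N.
  move=> Ax; rewrite truncn_lt_nat ?cell_ge0// -[ltRHS]mul1r ltr_pM2r//.
  rewrite ltr_pdivrMr ?mulr_gt0// mul1r.
  by have := fM _ i Ax; rewrite ler_norml => /andP[_ fM1]; lra.
pose U (q : {ffun 'I_p -> 'I_N}) := [set x | A x /\ forall i, cell i x = q i].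
have Udiam q x y : U q x -> U q y -> enorm (x - y) <= G / N%:R.
  move=> [Ax qx] [Ay qy]; apply: le_trans (enorm_le_norm _ _ _) _.
  have -> : G / N%:R = Num.sqrt d%:R * (K * (3 * M / N%:R)) by rewrite /G; ring.
  rewrite ler_wpM2l ?sqrtr_ge0//; apply: fK => // [|i].
    by rewrite divr_ge0 ?mulr_ge0 ?ler0n// ltW.
  rewrite ler_pdivlMr// -[leRHS]mulr1 -ler_pdivrMl ?mulr_gt0//.
  have /andP[x1 x2] := truncn_itv (cell_ge0 i x Ax).
  have /andP[y1 y2] := truncn_itv (cell_ge0 i y Ay).
  rewrite -/(cell i x) qx -?(natr1 _ (q i)) in x1 x2.
  rewrite -/(cell i y) qy -?(natr1 _ (q i)) in y1 y2.
  have -> : (3 * M)^-1 * (`|f i x - f i y| * N%:R) =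
    `|(f i x + M) / (3 * M) * N%:R - (f i y + M) / (3 * M) * N%:R|.
    have -> : (f i x + M) / (3 * M) * N%:R - (f i y + M) / (3 * M) * N%:R =
        (3 * M)^-1 * ((f i x - f i y) * N%:R) by ring.
    rewrite [RHS]normrM [in RHS]normrM gtr0_norm ?invr_gt0 ?mulr_gt0//.
    by rewrite (gtr0_norm N0).
  by rewrite ler_norml; lra.
have gaugeU q : (hausdorff_gauge p (U q) <= (v * (G / N%:R) ^+ p)%:E)%E.
  by apply: hausdorff_gauge_le; [rewrite divr_ge0|exact: Udiam].
apply: (@le_trans _ _ (\sum_q hausdorff_gauge p (U q))%E).
  apply: cover_content_le_sum.
  - by rewrite /= ediam0 leNye.
  - exact: hausdorff_gauge0.
  - exact: hausdorff_gauge_ge0.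
  - move=> q; apply: ge_ereal_sup => _ [x Ux [y Uy <-]].
    by rewrite lee_fin (le_trans (Udiam _ _ _ Ux Uy))// ltW.
  - move=> x Ax; exists [ffun i => Ordinal (cell_lt i x Ax)] => //.
    by split=> // i; rewrite ffunE.
apply: (@le_trans _ _ (\sum_(q : {ffun 'I_p -> 'I_N}) (v * (G / N%:R) ^+ p)%:E)%E).
  by apply: lee_sum => q _; exact: gaugeU.
rewrite sumEFin lee_fin sumr_const card_ffun !card_ord -[leLHS]mulr_natr natrX.
by rewrite -mulrA -exprMn divfK// gt_eqF.
Qed.

(** * Linear algebra and calculus near a regular point of [h] *)

Lemma norm_mulmx_le (R : realType) (d n : nat) (v : 'rV[R]_d) (A : 'M[R]_(d, n))
    (a b : R) : 0 <= a -> 0 <= b -> `|v| <= a -> (forall i j, `|A i j| <= b) ->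
  `|v *m A| <= d%:R * (a * b).
Proof.
move=> a0 b0 va Ab; apply: norm_rV_le => [|j]; first by rewrite !mulr_ge0.
rewrite mxE (le_trans (ler_norm_sum _ _ _))//.
rewrite (_ : d%:R * (a * b) = \sum_(i < d) a * b); last first.
  by rewrite sumr_const card_ord mulr_natl.
apply: ler_sum => i _; rewrite normrM ler_pM//.
exact: le_trans (ler_norm_coord _ _ _ _) va.
Qed.

Lemma mx_entries_bounded (R : realType) (d n : nat) (A : 'M[R]_(d, n)) :
  exists2 b, 0 <= b & forall i j, `|A i j| <= b.
Proof.
exists (\sum_i \sum_j `|A i j|) => [|i j].
  by apply: sumr_ge0 => i _; apply: sumr_ge0.
rewrite (bigD1 i)//= (bigD1 j)//= -addrA lerDl addr_ge0//.
  by apply: sumr_ge0.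
by apply: sumr_ge0 => ? _; apply: sumr_ge0.
Qed.

(** The rows of [B], a basis of a complement of the row space of [J^T], complete it to the whole
    space, so a vector annihilated by [J] and [B^T] is annihilated by the identity. Thus [P] is
    injective on the kernel of [J]. *)
Lemma transverse_mx (F : fieldType) (d m : nat) (J : 'M[F]_(d, m)) :
  \rank J = m -> exists P : 'M[F]_(d, d - m), row_free (row_mx J P).
Proof.
move=> Jm; have : \rank (J^T^C)%MS = (d - m)%N by rewrite mxrank_compl mxrank_tr Jm.
move=> rC; move: (row_base J^T^C)%MS (eq_row_base J^T^C)%MS; rewrite rC => B BC.
exists B^T; apply: inj_row_free => v.
rewrite mul_mx_row -[0]row_mx0 => /eq_row_mx[vJ vB].
have : (1%:M <= J^T + B)%MS.
  by rewrite (adds_eqmx (eqmx_refl _) BC) submx_full// addsmx_compl_full.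
case/sub_addsmxP => -[u1 u2] /= e1.
by rewrite -[v]mulmx1 -[1%:M]trmx1 e1 linearD/= !trmx_mul trmxK mulmxDr !mulmxA
  vJ vB !mul0mx addr0.
Qed.

Lemma row_free_bounded_below (R : realType) (d n : nat) (A : 'M[R]_(d, n)) :
  row_free A -> exists2 k, 0 <= k & forall v : 'rV[R]_d, `|v| <= k * `|v *m A|.
Proof.
move=> /row_freeP[B AB]; have [b b0 Bb] := mx_entries_bounded _ _ _ B.
exists (n%:R * b) => [|v]; first by rewrite mulr_ge0.
rewrite -{1}[v]mulmx1 -AB mulmxA -mulrA (mulrC b).
by apply: norm_mulmx_le.
Qed.

Lemma is_derive_coord (R : realType) (V : normedModType R) (n : nat)
    (f : V -> 'rV[R]_n) (a v : V) (df : 'rV[R]_n) (j : 'I_n) :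
  is_derive a v f df -> is_derive a v (fun x => f x 0 j) (df 0 j).
Proof.
move=> [fa dfE].
have fj : (fun t => t^-1 *: ((fun x => f x 0 j) (t *: v + a) - f a 0 j)) @ 0^' -->
    df 0 j.
  rewrite (_ : (fun _ => _) =
    (fun M : 'rV[R]_n => M 0 j) \o (fun t => t^-1 *: (f (t *: v + a) - f a))).
    rewrite -dfE; apply: continuous_cvg; first exact: coord_continuous.
    exact: fa.
  by apply/funext => t /=; rewrite !mxE.
apply: DeriveDef; first by apply/cvg_ex; exists (df 0 j).
exact: cvg_lim fj.
Qed.

(** The scalar mean value theorem is applied along the segment from [z] to [y]. For vector values
    the intermediate point varies with the coordinate, hence one [t] for each [j]. *)
Lemma mean_value_coord (R : realType) (d n : nat) (f : 'rV[R]_d -> 'rV[R]_n)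
    (y z : 'rV[R]_d) (j : 'I_n) : (forall x, differentiable f x) ->
  exists2 t, 0 <= t <= 1 &
    f y 0 j - f z 0 j = ((y - z) *m jacobian f (z + t *: (y - z))) 0 j.
Proof.
move=> df; pose v := y - z; pose w (t : R) := z + t *: v.
pose phi t := f (w t) 0 j.
have dphi (t : R) : is_derive t 1 phi ((v *m jacobian f (w t)) 0 j).
  apply: (@is_derive_coord _ _ _ (f \o w)).
  have shift_w (r : R) : w (r *: 1 + t) = r *: v + w t.
    by rewrite /w [r *: 1]mulr1 scalerDl addrCA.
  have [fd fE] : is_derive (w t) v f (v *m jacobian f (w t)).
    apply: DeriveDef; first exact: diff_derivable.
    by rewrite deriveEjacobian.
  have quotE : (fun r : R => r^-1 *: ((f \o w) (r *: 1 + t) - (f \o w) t)) =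
      (fun r : R => r^-1 *: (f (r *: v + w t) - f (w t))).
    by apply/funext => r /=; rewrite shift_w.
  by apply: DeriveDef; rewrite ?/derivable /derive quotE.
have phi_cont : continuous phi.
  by move=> t; apply/differentiable_continuous/derivable1_diffP; have [] := dphi t.
have [t] := @MVT_segment _ phi _ 0 1 ler01 (fun t _ => dphi t)
  (continuous_subspaceT phi_cont).
rewrite in_itv/= => t01; rewrite subr0 mulr1 /phi /w scale1r scale0r addr0 => fyz.
by exists t => //; rewrite -fyz /v (addrC z) subrK.
Qed.

(** On a level set each coordinate of [v *m jacobian h w] vanishes at some [w] between the two
    points. Hence [v *m jacobian h x] is small relative to [v], and injectivity of
    [row_mx (jacobian h x) P] leaves [v *m P] to control [v]. *)
Lemma level_set_transverse (R : realType) (d m : nat)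
    (h : 'rV[R]_d -> 'rV[R]_m) (x : 'rV[R]_d) :
  (forall y, differentiable h y) -> {for x, continuous (fun y => jacobian h y)} ->
  \rank (jacobian h x) = m ->
  exists e P K, [/\ 0 < e, 0 <= K & forall y z : 'rV[R]_d,
    ball x e y -> ball x e z -> h y = h z ->
    `|y - z| <= K * `|(y - z) *m (P : 'M[R]_(d, d - m))|].
Proof.
move=> dh cJ rJ; have [P JP] := transverse_mx _ _ _ _ rJ.
have [k k0 kJP] := row_free_bounded_below _ _ _ _ JP.
(* Chosen so that [k * d * eta <= 1/2]: half of the norm of [v] is absorbed on the left, whence the
   constant [2 * k]. The added 1 covers [k * d = 0]. *)
pose eta := (2 * (k * d%:R + 1))^-1.
have kd0 : 0 <= k * d%:R by rewrite mulr_ge0.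
have eta0 : 0 < eta by rewrite invr_gt0; lra.
have [e /= e0 eJ] : nbhs_ball x (fun y => ball (jacobian h x) eta (jacobian h y)).
  by apply/nbhs_ballP; apply: cJ; exact: nbhsx_ballx.
exists e, P, (2 * k); split=> //; first by rewrite mulr_ge0.
move=> y z xy xz hyz; set v := y - z.
have vJ : `|v *m jacobian h x| <= d%:R * (`|v| * eta).
  apply: norm_rV_le => [|j]; first by rewrite !mulr_ge0// ltW.
  have [t t01] := mean_value_coord _ _ _ _ y z j dh.
  rewrite hyz subrr -/v; set w := z + _ => /esym vw0.
  have xw : ball x e w.
    move: xy xz; rewrite -ball_normE/= => xy xz.
    (* Convexity of the ball, with the larger of the two distances as a common bound below [e]. *)
    have -> : x - w = (1 - t) *: (x - z) + t *: (x - y).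
      by rewrite /w /v; apply/rowP => i; rewrite !mxE; ring.
    case/andP: t01 => t0 t1; apply: le_lt_trans (ler_normD _ _) _.
    rewrite !normrZ (ger0_norm t0) ger0_norm ?subr_ge0//.
    pose c := Num.max `|x - z| `|x - y|.
    have ce : c < e by rewrite gt_max xz xy.
    have zc : `|x - z| <= c by rewrite le_max lexx.
    have yc : `|x - y| <= c by rewrite le_max lexx orbT.
    have t1' : 0 <= 1 - t by rewrite subr_ge0.
    have := ler_wpM2l t0 yc; have := ler_wpM2l t1' zc; lra.
  (* Subtracting [v *m jacobian h w], whose coordinate [j] is zero, leaves the variation of the
     Jacobian, at most [eta] in each entry. *)
  rewrite -[v *m jacobian h x](subrK (v *m jacobian h w)) mxE vw0 addr0 -mulmxBr.
  apply: le_trans (ler_norm_coord _ _ _ _) _.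
  apply: norm_mulmx_le => //; first exact: ltW.
  move=> i j'; have [_ /(_ i j')] := eJ w xw.
  rewrite -ball_normE => Jij; rewrite mxE [X in _ + X]mxE.
  exact: ltW Jij.
have := kJP v; rewrite mul_mx_row => kv.
have : `|row_mx (v *m jacobian h x) (v *m P)| <=
    d%:R * (`|v| * eta) + `|v *m P|.
  apply: norm_rV_le => [|i]; first by rewrite addr_ge0// !mulr_ge0// ltW.
  case: (split_ordP i) => i' ->; rewrite ?row_mxEl ?row_mxEr;
    apply: le_trans (ler_norm_coord _ _ _ _) _.
    by apply: le_trans vJ _; rewrite lerDl.
  by rewrite lerDr !mulr_ge0// ltW.
move=> /(ler_wpM2l k0)/(le_trans kv).
have -> : k * (d%:R * (`|v| * eta) + `|v *m P|) =
  k * d%:R * eta * `|v| + k * `|v *m P| by ring.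
have kde : k * d%:R * eta <= 2^-1.
  by rewrite /eta ler_pdivrMr; lra.
have := ler_wpM2r (normr_ge0 v) kde; lra.
Qed.

Lemma level_set_locally_finite (R : realType) (d m : nat)
    (h : 'rV[R]_d -> 'rV[R]_m) (x : 'rV[R]_d) :
  (forall y, differentiable h y) -> {for x, continuous (fun y => jacobian h y)} ->
  \rank (jacobian h x) = m ->
  exists2 e : R, 0 < e &
    (hausdorff (d - m) ([set y | h y = 0%R] `&` ball x e) < +oo)%E.
Proof.
move=> dh cJ rJ; have [e [P [K [e0 K0 KP]]]] := level_set_transverse _ _ _ _ _ dh cJ rJ.
exists e => //; have [b b0 Pb] := mx_entries_bounded _ _ _ P.
pose M := d%:R * ((`|x| + e) * b).
have M0 : 0 <= M by rewrite !mulr_ge0// addr_ge0// ltW.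
(* The coordinates of [y *m P] serve as grid coordinates; [M + 1] stays positive even when
   [M = 0]. *)
apply: (@hausdorff_lt_pinfty _ _ _ _ (fun i y => (y *m P) 0 i) (M + 1) K) => //.
- by lra.
- move=> y i [_ xy]; apply: le_trans (ler_norm_coord _ _ _ _) _.
  apply: (@le_trans _ _ M); last by rewrite lerDl.
  apply: norm_mulmx_le => //; first by rewrite addr_ge0// ltW.
  move: xy; rewrite -ball_normE/= => xy.
  rewrite -[y](subKr x) (le_trans (ler_normB _ _))// lerD2l ltW//.
- move=> y z r r0 [hy xy] [hz xz] yzr.
  apply: le_trans (KP _ _ xy xz _) _; first by rewrite hy hz.
  rewrite ler_wpM2l//; apply: norm_rV_le => // i.
  by rewrite mulmxBl mxE [X in _ + X]mxE; exact: yzr.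
Qed.

Lemma compact_outer_measure_lt_pinfty (R : realType) (V : normedModType R)
    (mu : {outer_measure set V -> \bar R}) (K : set V) : compact K ->
  (forall x, K x -> exists2 e, 0 < e & (mu (K `&` ball x e) < +oo)%E) ->
  (mu K < +oo)%E.
Proof.
rewrite compact_cover => Kc Kloc.
have [e eP] : {e : V -> R & forall x, K x ->
    0 < e x /\ (mu (K `&` ball x (e x)) < +oo)%E}.
  apply: (@choice _ _ (fun x e => K x -> 0 < e /\ (mu (K `&` ball x e) < +oo)%E)).
  move=> x; have [/Kloc[e e0 eK]|nKx] := pselect (K x); first by exists e.
  by exists 0.
have [|D DK KD] := Kc _ K (fun x => ball x (e x)) (fun x _ => ball_open x (e x)).
  by move=> x Kx; exists x => //; apply: ballxx; case: (eP x Kx).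
have {}DK x : x \in D -> K x by move=> /DK; rewrite inE.
apply: (@le_lt_trans _ _ (mu (\big[setU/set0]_(x <- D) (K `&` ball x (e x))))).
  apply: le_outer_measure; rewrite -bigcup_fset => x Kx.
  by have [y Dy xy] := KD x Kx; exists y.
rewrite big_seq_cond; elim/big_rec: _ => [|x U /andP[xD _] IH].
  by rewrite outer_measure0.
apply: le_lt_trans (outer_measureU2 _ _ _) _.
by rewrite lte_add_pinfty//; exact: (eP x (DK x xD)).2.
Qed.

(** The gradients of [h] are the columns of its Jacobian and come first in the active family. A
    prefix of a free family is free, so the columns are independent. *)
Lemma LICQ_rank_jacobian (R : realType) (d m l : nat)
    (h : 'rV[R]_d -> 'rV[R]_m) (g : 'rV[R]_d -> 'rV[R]_l) (x : 'rV[R]_d) :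
  LICQ h g -> feasible h g x -> differentiable h x -> \rank (jacobian h x) = m.
Proof.
move=> licq Sx dh; rewrite -mxrank_tr; apply/eqP; apply: inj_row_free => v vJ.
have gradE j : gradient (fun y => h y 0 j) x = row j (jacobian h x)^T.
  apply/rowP => i; rewrite mxE.
  have dhi : is_derive x (delta_mx 0 i) h (delta_mx 0 i *m jacobian h x).
    by apply: DeriveDef; [exact: diff_derivable|rewrite deriveEjacobian].
  have [_ ->] := is_derive_coord _ _ _ _ _ _ _ j dhi.
  by rewrite -rowE [LHS]mxE [RHS]mxE [RHS]mxE.
have /catl_free : free ([tuple gradient (fun y => h y 0 j) x | j < m] ++
  [seq gradient (fun y => g y 0 i) x | i <- enum 'I_l & g x 0 i == 0]).
  exact: licq.
move=> /freeP/(_ (v 0)) v0; apply/rowP => j; rewrite [RHS]mxE; apply: v0.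
rewrite -[RHS]vJ mulmx_sum_row; apply: eq_bigr => i _.
by rewrite -tnth_nth tnth_mktuple gradE.
Qed.

Section feasible_set.
Context (R : realType) (d m l : nat).
Context (h : 'rV[R]_d -> 'rV[R]_m) (g : 'rV[R]_d -> 'rV[R]_l).
Hypotheses (dh : forall x, differentiable h x) (dg : forall x, differentiable g x).

Lemma closed_feasible : closed (feasible h g).
Proof.
rewrite (_ : feasible h g = h @^-1` [set 0] `&`
    \bigcap_i ((fun x => g x 0 i) @^-1` [set r | r <= 0])); last first.
  apply/seteqP; split=> x [hx gx]; first by split=> // i _; exact: gx.
  by split=> // i; exact: gx.
apply: closedI.
  apply: preimage_closed; last first.
    by apply: accessible_closed_set1; apply: hausdorff_accessible; exact: norm_hausdorff.
  by move=> x _; exact: differentiable_continuous.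
apply: closed_bigI => i _; apply: preimage_closed; last exact: closed_le.
move=> x _; apply: (@continuous_comp _ _ _ g (fun M : 'rV[R]_l => M 0 i)).
  exact: differentiable_continuous.
exact: coord_continuous.
Qed.

Lemma hausdorff_feasible_lt_pinfty : bounded_set (feasible h g) ->
  (forall x, {for x, continuous (fun y => jacobian h y)}) -> LICQ h g ->
  (hausdorff (d - m) (feasible h g) < +oo)%E.
Proof.
move=> bS cJ licq.
apply: (@compact_outer_measure_lt_pinfty _ _ (hausdorff_outer R d (d - m))).
  exact: bounded_closed_compact closed_feasible.
move=> x Sx.
have [e e0 he] := level_set_locally_finite _ _ _ _ x dh (cJ x)
  (LICQ_rank_jacobian _ _ _ _ _ _ _ licq Sx (dh x)).
exists e => //; apply: le_lt_trans he.
by apply: le_hausdorff => y [[hy _] xy].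
Qed.

End feasible_set.

(** * The finite divergence along the mean-field iterates *)

(** With denominators cleared, this is [tanh u <= u]: the difference [f] of the two sides vanishes
    at 0 and has derivative [u * (expR u - expR (- u))]. *)
Lemma tanh_le (R : realType) (u : R) : 0 <= u ->
  (1 - u) * expR u <= (1 + u) * expR (- u).
Proof.
move=> u0; pose f := fun u : R => (1 + u) * expR (- u) - (1 - u) * expR u.
have df (x : R) : is_derive x 1 f (x * (expR x - expR (- x))).
  apply: is_derive_eq; rewrite /GRing.scale/=; ring.
have fcont : continuous f.
  by move=> x; apply/differentiable_continuous/derivable1_diffP; have [] := df x.
have [c] := @MVT_segment _ f _ 0 u u0 (fun x _ => df x)
  (continuous_subspaceT fcont).
rewrite in_itv/= => /andP[c0 cu].
have f0 : f 0 = 0 by rewrite /f oppr0 !addr0 subrr.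
rewrite f0 !subr0 => fu.
have : 0 <= f u by rewrite fu !mulr_ge0// subr_ge0 ler_expR; lra.
by rewrite subr_ge0.
Qed.

(* The oscillation of the logarithm dominates the chord bound: this is
   [tanh (s / 4) <= s / 4] with [s = b - a], after the AM-GM step
   [(1 - e^a) (e^b - 1) <= (e^(b/2) - e^(a/2))^2]. *)
Lemma chord_bound (R : realType) (a b : R) : a <= b ->
  4 * ((1 - expR a) * (expR b - 1)) <= (b - a) * (expR b - expR a).
Proof.
(* With these choices [w * p] and [w * q] are the exponentials of [b / 2] and [a / 2]. *)
move=> ab; pose u := (b - a) / 4; pose w := expR ((a + b) / 4).
have u0 : 0 <= u by rewrite /u; lra.
set p := expR u; set q := expR (- u).
have qp : q <= p by rewrite ler_expR; lra.
have Eb : expR b = (w * p) ^+ 2.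
  by rewrite /w /p -expRD expr2 -expRD; congr expR; rewrite /u; field.
have Ea : expR a = (w * q) ^+ 2.
  by rewrite /w /q -expRD expr2 -expRD; congr expR; rewrite /u; field.
have th := tanh_le _ _ u0; rewrite -/p -/q in th.
rewrite Ea Eb (_ : b - a = 4 * u); last by rewrite /u; field.
apply: (@le_trans _ _ (4 * (w * p - w * q) ^+ 2)).
  (* The defect in the AM-GM step is an exact square. *)
  have : 0 <= (w ^+ 2 * (p * q) - 1) ^+ 2 by exact: sqr_ge0.
  have -> : 4 * (w * p - w * q) ^+ 2 =
    4 * ((1 - (w * q) ^+ 2) * ((w * p) ^+ 2 - 1)) + 4 * (w ^+ 2 * (p * q) - 1) ^+ 2
      by ring.
  lra.
rewrite -subr_ge0 (_ : _ - _ =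
  4 * w ^+ 2 * (p - q) * ((1 + u) * q - (1 - u) * p)); last by ring.
apply: mulr_ge0; last by rewrite subr_ge0.
apply: mulr_ge0; last by rewrite subr_ge0.
by rewrite mulr_ge0 ?sqr_ge0.
Qed.

Lemma ln_le_sub1 (R : realType) (y : R) : 0 < y -> ln y <= y - 1.
Proof. by move=> y0; rewrite -{1}(subrK 1 y) addrC le_ln1Dx//; lra. Qed.

Section finite_KL.
Context (R : realType) (C : nat) (a s : 'I_C -> R).
Hypotheses (a_gt0 : forall c, 0 < a c) (s_gt0 : forall c, 0 < s c).
Hypotheses (a1 : \sum_c a c = 1) (s1 : \sum_c s c = 1).

(** Gibbs' inequality: [ln y <= y - 1] at [y = s c / a c], where the differences [a c - s c] sum to
    zero. *)
Lemma finite_KL_ge0 : 0 <= \sum_c a c * ln (a c / s c).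
Proof.
have as0 : \sum_c (a c - s c) = 0 by rewrite sumrB a1 s1 subrr.
rewrite -[leLHS]as0; apply: ler_sum => c _.
have := ln_le_sub1 _ (s c / a c) (divr_gt0 (s_gt0 c) (a_gt0 c)).
rewrite -(invf_div (a c)) lnV ?posrE ?divr_gt0// => h.
rewrite -subr_ge0 (_ : _ - _ = a c * ((a c / s c)^-1 - 1 + ln (a c / s c))).
  by apply: mulr_ge0; [rewrite ltW|rewrite -[ln _]opprK subr_ge0].
by field; rewrite !gt_eqF.
Qed.

Lemma finite_KL_le (lo hi : R) :
  (forall c, lo <= ln (a c / s c) <= hi) ->
  \sum_c a c * ln (a c / s c) <= 4^-1 * (hi - lo) ^+ 2.
Proof.
set x := fun c => ln (a c / s c) => xb.
have y_gt0 c : 0 < a c / s c by rewrite divr_gt0.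
have aE c : a c = s c * expR (x c).
  by rewrite lnK ?posrE// mulrC divfK// gt_eqF.
have sy1 : \sum_c s c * expR (x c) = 1.
  by rewrite -a1; apply: eq_bigr => c _; rewrite -aE.
have sy0 : \sum_c s c * (expR (x c) - 1) = 0.
  under eq_bigr do rewrite mulrBr mulr1.
  by rewrite sumrB sy1 s1 subrr.
have yb c : expR lo <= expR (x c) <= expR hi by rewrite !ler_expR; exact: xb.
have lo1 : expR lo <= 1.
  rewrite -sy1 -[leLHS]mul1r -s1 mulr_suml; apply: ler_sum => c _.
  by rewrite ler_pM2l//; case/andP: (yb c).
have hi1 : 1 <= expR hi.
  rewrite -sy1 -[leRHS]mul1r -s1 mulr_suml; apply: ler_sum => c _.
  by rewrite ler_pM2l//; case/andP: (yb c).
have lohi : lo <= hi by rewrite -ler_expR (le_trans lo1).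
(* Twice the total variation distance, as [s c * expR (x c)] is [a c]. *)
pose T := \sum_c s c * `|expR (x c) - 1|.
(* The convex function [|y - 1|] lies below its chord on [[expR lo, expR hi]]. Averaging the chord
   over [s], for which [y] has mean 1, gives its value at 1. *)
have Tle : (expR hi - expR lo) * T <= 2 * ((1 - expR lo) * (expR hi - 1)).
  have -> : 2 * ((1 - expR lo) * (expR hi - 1)) = \sum_c s c *
      ((expR hi - expR (x c)) * (1 - expR lo) +
       (expR (x c) - expR lo) * (expR hi - 1)).
    under eq_bigr => c _.
      rewrite (_ : _ * _ = (2 * ((1 - expR lo) * (expR hi - 1))) * s c +
        ((expR hi + expR lo - 2) * (s c * (expR (x c) - 1)))); last by ring.
      over.
    by rewrite big_split/= -!mulr_sumr s1 sy0; ring.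
  rewrite mulr_sumr; apply: ler_sum => c _.
  rewrite mulrCA ler_pM2l//; have /andP[? ?] := yb c.
  have [y1|y1] := ger0P (expR (x c) - 1); rewrite -subr_ge0.
    rewrite (_ : _ - _ = 2 * ((expR hi - expR (x c)) * (1 - expR lo))).
      by rewrite !mulr_ge0// ?subr_ge0// ltW.
    by ring.
  rewrite (_ : _ - _ = 2 * ((expR (x c) - expR lo) * (expR hi - 1))).
    by rewrite !mulr_ge0// subr_ge0.
  by ring.
have {}Tle : T <= (hi - lo) / 2.
  (* If [lo = hi], then [expR lo <= 1 <= expR hi] forces every ratio to be 1; otherwise
     [expR hi - expR lo] can be divided out. *)
  have [lohiE|lohiN] := eqVneq lo hi.
    rewrite lohiE subrr mul0r /T big1// => c _.
    have -> : expR (x c) = 1.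
      by apply/eqP; rewrite eq_le; have := yb c; rewrite lohiE in lo1 *; lra.
    by rewrite subrr normr0 mulr0.
  have eh : 0 < expR hi - expR lo.
    by rewrite subr_gt0 ltr_expR lt_neqAle lohiN.
  rewrite -(ler_pM2l eh); have := chord_bound _ _ _ lohi; lra.
(* Adding the divergence of [s] from [a], which is nonnegative, symmetrises the sum. Since the
   weights [s c * (expR (x c) - 1)] sum to zero, [x] may be centred at the midpoint. *)
apply: (@le_trans _ _ (\sum_c s c * (expR (x c) - 1) * (x c - (lo + hi) / 2))).
  have -> : \sum_c s c * (expR (x c) - 1) * (x c - (lo + hi) / 2) =
      \sum_c s c * (expR (x c) - 1) * x c.
    under eq_bigr do rewrite mulrBr.
    by rewrite sumrB -mulr_suml sy0 mul0r subr0.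
  rewrite -subr_ge0 -sumrB -oppr_le0 -sumrN -[leRHS]sy0.
  apply: ler_sum => c _; rewrite -/(x c) {1}aE.
  rewrite (_ : - _ = s c * x c); last by ring.
  by rewrite ler_pM2l// {2}/x lnK ?posrE// ln_le_sub1.
apply: (@le_trans _ _ ((hi - lo) / 2 * T)); last first.
  have -> : 4^-1 * (hi - lo) ^+ 2 = (hi - lo) / 2 * ((hi - lo) / 2) by field.
  by rewrite ler_wpM2l//; lra.
rewrite mulr_sumr; apply: ler_sum => c _.
rewrite mulrCA -mulrA ler_pM2l// (le_trans (ler_norm _))// normrM mulrC.
by rewrite ler_wpM2r// ler_norml; have := xb c; rewrite -/(x c); lra.
Qed.

End finite_KL.

(** * The mean-field iterates in log-ratio coordinates *)

Section mean_field_iterates.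
Context (R : realType) (C : nat) (beta : R) (s alpha0 : 'I_C -> R).
Hypotheses (s_gt0 : forall c, 0 < s c) (alpha0_gt0 : forall c, 0 < alpha0 c).
Hypotheses (s1 : \sum_c s c = 1) (alpha0_1 : \sum_c alpha0 c = 1).

Let normalizer_gt0 (a : 'I_C -> R) : (forall c, 0 < a c) ->
  0 < \sum_c a c `^ (1 - beta) * s c `^ beta.
Proof.
move=> a0; have [C0|C0] := leqP C 0.
  by move: s1; rewrite big1 => [/esym/eqP|[c ltc]]; rewrite ?oner_eq0//; lia.
rewrite (bigD1 (Ordinal C0))//= ltr_wpDr ?mulr_gt0 ?powR_gt0//.
by apply: sumr_ge0 => c _; rewrite mulr_ge0 ?powR_ge0.
Qed.

Lemma mean_field_gt0 t c : 0 < mean_field beta s alpha0 t c.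
Proof.
elim: t c => [//|t IH] c; rewrite /mean_field iterS.
by rewrite divr_gt0 ?normalizer_gt0// mulr_gt0 ?powR_gt0//; exact: IH.
Qed.

Lemma mean_field_sum1 t : \sum_c mean_field beta s alpha0 t c = 1.
Proof.
case: t => [//|t]; rewrite /mean_field iterS -mulr_suml divff//.
by rewrite gt_eqF// normalizer_gt0// => c; exact: mean_field_gt0.
Qed.

(** The denominators of [Phi] only enter the shift [k], which is common to all components and so
    cancels in every difference of log-ratios. *)
Lemma mean_field_log_ratio t : exists k, forall c,
  ln (mean_field beta s alpha0 t c / s c) =
  (1 - beta) ^+ t * ln (alpha0 c / s c) - k.
Proof.
elim: t => [|t [k IH]]; first by exists 0 => c; rewrite expr0 mul1r subr0.
set a := mean_field beta s alpha0 t.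
exists ((1 - beta) * k + ln (\sum_c a c `^ (1 - beta) * s c `^ beta)) => c.
have a0 c' : 0 < a c' by exact: mean_field_gt0.
have Z0 := normalizer_gt0 _ a0.
have := IH c; rewrite -/a /mean_field iterS -/(mean_field _ _ _ _) -/a /Phi.
rewrite !ln_div ?posrE ?mulr_gt0 ?divr_gt0 ?invr_gt0 ?powR_gt0//.
rewrite lnM ?posrE ?powR_gt0// !ln_powR exprS => h.
have -> : ln (a c) = ln (s c) + ((1 - beta) ^+ t * (ln (alpha0 c) - ln (s c)) - k).
  by rewrite -h addrC subrK.
by ring.
Qed.

Lemma mean_field_KL_le t : beta <= 1 ->
  \sum_c mean_field beta s alpha0 t c * ln (mean_field beta s alpha0 t c / s c)
  <= log_ratio_constant s alpha0 * (1 - beta) ^+ (2 * t).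
Proof.
move=> beta1; have [k ak] := mean_field_log_ratio t.
set r := fun c => ln (alpha0 c / s c).
(* A finite bound on the log-ratios, which makes [sup] and [inf] genuine bounds of their range. *)
have rb c : `|r c| <= \sum_c `|r c|.
  by rewrite (bigD1 c)//= lerDl sumr_ge0.
have q0 : 0 <= (1 - beta) ^+ t by rewrite exprn_ge0// subr_ge0.
(* The bounds are the affine images of the initial extremes; [k] cancels in their difference. *)
have := @finite_KL_le _ _ _ _ (mean_field_gt0 t) s_gt0 (mean_field_sum1 t) s1
  ((1 - beta) ^+ t * inf (range r) - k) ((1 - beta) ^+ t * sup (range r) - k).
have -> : (1 - beta) ^+ t * sup (range r) - k -
    ((1 - beta) ^+ t * inf (range r) - k) =
  (1 - beta) ^+ t * (sup (range r) - inf (range r)) by ring.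
have -> : log_ratio_constant s alpha0 * (1 - beta) ^+ (2 * t) =
    4^-1 * ((1 - beta) ^+ t * (sup (range r) - inf (range r))) ^+ 2.
  rewrite /log_ratio_constant -/r exprMn -exprM (mulnC t) -mulrA.
  by rewrite [X in _ * X = _]mulrC.
apply => c.
rewrite ak !lerD2r; apply/andP; split; apply: ler_wpM2l => //.
  apply: ge_inf; last by exists c.
  exists (- \sum_c `|r c|) => _ [c' _ <-].
  by have := rb c'; rewrite ler_norml => /andP[].
apply: ub_le_sup; last by exists c.
exists (\sum_c `|r c|) => _ [c' _ <-].
by have := rb c'; rewrite ler_norml => /andP[].
Qed.

End mean_field_iterates.

(** * Divergence of piecewise constant densities *)

Section components.
Context (R : realType) (disp : measure_display) (T : measurableType disp).
Context (mu : {measure set T -> \bar R}) (C : nat) (A : 'I_C -> set T).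
Hypothesis mA : forall c, measurable (A c).
Hypothesis Afin : forall c, (mu (A c) < +oo)%E.
Hypothesis Atriv : trivIset setT A.

Let D := \bigcup_c A c.

Let mD : measurable D.
Proof. by rewrite /D; apply: fin_bigcup_measurable. Qed.

Lemma sum_indic_component (k : 'I_C -> R) c x : A c x ->
  \sum_c' k c' * \1_(A c') x = k c.
Proof.
move=> Ax; rewrite (bigD1 c)//= indicE mem_set// mulr1 big1 ?addr0// => c' c'c.
rewrite indicE memNset ?mulr0// => Ac'x; move/eqP: c'c; apply.
by apply: Atriv => //; exists x.
Qed.

(** On the union [f] is a finite combination of indicators, each integrable because its component
    has finite measure. *)
Lemma integral_piecewise_cst (f : T -> \bar R) (k : 'I_C -> R) :
  (forall c x, A c x -> f x = (k c)%:E) ->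
  (\int[mu]_(x in D) f x = \sum_c (k c)%:E * mu (A c))%E.
Proof.
move=> fk; have Ifin c : mu.-integrable D (EFin \o \1_(A c)).
  apply/integrableP; split.
    by apply/measurable_EFinP; exact: measurable_indic.
  rewrite (eq_integral (fun x => (\1_(A c) x)%:E)) => [|x _]; last first.
    by rewrite /= ger0_norm.
  rewrite integral_indic// (le_lt_trans _ (Afin c))// le_measure ?inE//.
  exact: measurableI.
rewrite (eq_integral (fun x => (\sum_c (k c)%:E * (\1_(A c) x)%:E)%E)); last first.
  move=> x; rewrite inE => -[c _ Ax]; rewrite (fk _ _ Ax).
  by rewrite -(sum_indic_component k _ _ Ax) -sumEFin.
rewrite integral_sum//; last by move=> c; exact: (integrableZl mD (k c) (Ifin c)).
apply: eq_bigr => c _; rewrite (integralZl mD (Ifin c)) integral_indic//.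
congr (_ * mu _)%E; apply/setIidPl => x Ax.
by exists c.
Qed.

Lemma measure_components : mu D = (\sum_c mu (A c))%E.
Proof.
have := integral_piecewise_cst (cst 1%E) (fun=> 1) (fun _ _ _ => erefl).
rewrite integral_cst// mul1e => ->.
by apply: eq_bigr => c _; rewrite mul1e.
Qed.

Hypothesis A_gt0 : forall c, (0 < mu (A c))%E.

Let sigma c := fine (mu (A c)).

Let S := fine (mu D).

Let sigmaE c : mu (A c) = (sigma c)%:E.
Proof. by rewrite fineK// ge0_fin_numE. Qed.

Lemma component_measure_gt0 c : 0 < sigma c.
Proof. by rewrite -lte_fin -sigmaE. Qed.

Lemma total_measure : S = \sum_c sigma c.
Proof.
by rewrite /S measure_components (eq_bigr _ (fun c _ => sigmaE c)) sumEFin.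
Qed.

Lemma component_densityE (a : 'I_C -> R) c x : A c x ->
  component_density A sigma a x = a c / sigma c.
Proof. exact: sum_indic_component. Qed.

(** On [A c] the volumes cancel inside the logarithm, and the constant integrand, whose prefactor is
    [a c / sigma c], is multiplied by [sigma c]. *)
Lemma KL_component_density (a b : 'I_C -> R) :
  (forall c, 0 < a c) -> (forall c, 0 < b c) ->
  KL mu D (component_density A sigma a) (component_density A sigma b) =
  (\sum_c a c * ln (a c / b c))%:E.
Proof.
move=> a0 b0; rewrite /KL (integral_piecewise_cst _
  (fun c => a c / sigma c * ln (a c / b c))) => [|c x Ax].
  rewrite -sumEFin; apply: eq_bigr => c _; rewrite sigmaE -EFinM.
  by rewrite mulrAC divfK// gt_eqF// component_measure_gt0.
have s0 := component_measure_gt0 c.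
rewrite !(component_densityE _ _ _ Ax) /kl_term.
rewrite !mulf_eq0 !invr_eq0 !gt_eqF//=.
by congr (_ * ln _)%:E; field; rewrite !gt_eqF.
Qed.

Lemma KL_uniform_density (rho : T -> R) :
  KL mu D rho (uniform_density D S) =
  KL mu D rho (component_density A sigma (fun c => sigma c / S)).
Proof.
apply: eq_integral => x; rewrite inE => Dx; congr (kl_term _ _).
have [c _ Ax] := Dx; rewrite (component_densityE _ _ _ Ax).
rewrite /uniform_density indicE mem_set// mulr1 mulrAC divff ?mul1r//.
by rewrite gt_eqF// component_measure_gt0.
Qed.

End components.

(** * Enumerated components and assembly of the result *)

Lemma enumerated_components_trivIset (T : topologicalType) (B : set T) (C : nat)
    (A : 'I_C -> set T) : enumerates_components B A -> trivIset setT A.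
Proof.
move=> [injA rA] c c' _ _ [x [Acx Ac'x]]; apply: injA.
have compE e : A e x -> A e = connected_component B x.
  move=> Aex; have : range A (A e) by exists e.
  rewrite rA => -[y By yE]; rewrite -yE; apply: same_connected_component.
  by rewrite yE.
by rewrite (compE c) // (compE c').
Qed.

Lemma enumerated_components_cover (T : topologicalType) (B : set T) (C : nat)
    (A : 'I_C -> set T) : enumerates_components B A -> \bigcup_c A c = B.
Proof.
by move=> [_ rA]; rewrite -[RHS]connected_component_cover -rA bigcup_image.
Qed.

Lemma KL_mean_field (R : realType) (disp : measure_display)
    (T : measurableType disp) (mu : {measure set T -> \bar R}) (C : nat)
    (A : 'I_C -> set T) (beta : R) (alpha0 : 'I_C -> R) :
  let D := \bigcup_c A c in
  let sigma := fun c => fine (mu (A c)) in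
  let S := fine (mu D) in
  let astar := fun c => sigma c / S in
  let alpha := mean_field beta astar alpha0 in
  let density := component_density A sigma in
  (forall c, measurable (A c)) -> trivIset setT A -> (mu D < +oo)%E ->
  (forall c, 0 < mu (A c))%E -> 0 < beta -> beta < 1 ->
  (forall c, 0 < alpha0 c) -> \sum_c alpha0 c = 1 ->
  (forall t : nat, (KL mu D (density (alpha t)) (density astar) <=
      (log_ratio_constant astar alpha0 * (1 - beta) ^+ (2 * t))%:E)%E) /\
  KL mu D (density (alpha t)) (uniform_density D S)
    @[t --> \oo] --> (0 : \bar R)%E.
Proof.
move=> D sigma S astar alpha density mA tA Dfin mu_gt0 beta0 beta1 alpha0_gt0 alpha0_1.
have AD c : A c `<=` D by move=> x Ax; exists c.
have A_fin c : (mu (A c) < +oo)%E.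
  apply: le_lt_trans Dfin; apply: le_measure; rewrite ?inE//.
  exact: fin_bigcup_measurable.
have sigma_gt0 : forall c, 0 < sigma c.
  by move=> c; exact: component_measure_gt0.
have SE : S = \sum_c sigma c by exact: total_measure.
(* If [S] were 0 there could be no component, each having positive volume, yet [alpha0] sums to
   1. *)
have S_gt0 : 0 < S.
  rewrite lt_neqAle SE sumr_ge0 ?andbT => [|c _]; last exact: ltW.
  apply/negP => /eqP/esym S0; move: alpha0_1; rewrite big1 => [/esym/eqP|c _].
    by rewrite oner_eq0.
  have := sigma_gt0 c; rewrite (psumr_eq0P _ S0) ?ltxx// => c' _.
  exact: ltW.
have astar_gt0 c : 0 < astar c by rewrite divr_gt0.
have astar1 : \sum_c astar c = 1 by rewrite -mulr_suml -SE divff// gt_eqF.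
have alpha_gt0 t c : 0 < alpha t c by exact: mean_field_gt0.
pose K t := \sum_c alpha t c * ln (alpha t c / astar c).
have KLE t : KL mu D (density (alpha t)) (density astar) = (K t)%:E.
  exact: KL_component_density.
have K_le t : K t <= log_ratio_constant astar alpha0 * (1 - beta) ^+ (2 * t).
  by apply: mean_field_KL_le => //; exact: ltW.
have K_ge0 t : 0 <= K t by apply: finite_KL_ge0 => //; exact: mean_field_sum1.
split=> [t|]; first by rewrite KLE lee_fin.
have -> : (fun t => KL mu D (density (alpha t)) (uniform_density D S)) =
    (fun t => (K t)%:E).
  by apply/funext => t; rewrite -KLE; exact: KL_uniform_density.
apply: cvg_EFin; first by apply: nearW.
have q1 : `|(1 - beta) ^+ 2| < 1 by rewrite ger0_norm ?sqr_ge0// expr2; nra.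
have pow_cvg : ((1 - beta) ^+ (2 * t))%R @[t --> \oo] --> (0 : R).
  have -> : (fun t => (1 - beta) ^+ (2 * t)) = GRing.exp ((1 - beta) ^+ 2).
    by apply/funext => t; rewrite exprM.
  exact: cvg_expr.
have bound_cvg : log_ratio_constant astar alpha0 * (1 - beta) ^+ (2 * t)
    @[t --> \oo] --> log_ratio_constant astar alpha0 * 0.
  exact: cvgMl_tmp.
rewrite mulr0 in bound_cvg.
apply: squeeze_cvgr (cvg_cst 0) bound_cvg.
by apply: nearW => t; rewrite K_ge0 K_le.
Qed.

Theorem theorem1 (R : realType) (d m l : nat)
    (h : 'rV[R]_d -> 'rV[R]_m) (g : 'rV[R]_d -> 'rV[R]_l)
    (C : nat) (Sigma_ : 'I_C -> set 'rV[R]_d)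
    (tau : R) (alpha0 : 'I_C -> R) :
  let Sigma := feasible h g in
  let p := (d - m)%N in
  let mu := hausdorff_measure R d p in
  let sigma := fun c => fine (mu (Sigma_ c)) in
  let S := fine (mu Sigma) in
  let astar := fun c => sigma c / S in
  let beta := tau / p%:R in
  let alpha := mean_field beta astar alpha0 in
  let density := component_density Sigma_ sigma in
  twice_diff_lip h -> twice_diff_lip g -> LICQ h g ->
  Sigma !=set0 -> bounded_set Sigma ->
  enumerates_components Sigma Sigma_ ->
  (forall c, 0 < mu (Sigma_ c))%E ->
  0 < tau -> tau < p%:R ->
  (forall c, 0 < alpha0 c) -> \sum_(c < C) alpha0 c = 1 ->
  (forall t : nat,
     (KL mu Sigma (density (alpha t)) (density astar) <=
      (log_ratio_constant astar alpha0 *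
       (1 - tau / p%:R) ^+ (2 * t))%:E)%E) /\
  KL mu Sigma (density (alpha t)) (uniform_density Sigma S)
    @[t --> \oo] --> (0 : \bar R)%E.
Proof.
move=> Sigma p mu sigma S astar beta alpha density dh dg licq S0 bS comp.
move=> mu_gt0 tau0 taup alpha0_gt0 alpha0_1.
have [[h_diff h_jac _] [g_diff _ _]] := (dh, dg).
have cSigma : closed Sigma by exact: closed_feasible.
have Sigma_fin : (mu Sigma < +oo)%E.
  apply: hausdorff_feasible_lt_pinfty => // x.
  exact: differentiable_continuous.
(* Components of a closed set are closed, hence Caratheodory measurable. *)
have mA c : measurable (Sigma_ c : set (caratheodory_type (hausdorff_outer R d p))).
  apply: closed_hausdorff_measurable.
  have : range Sigma_ (Sigma_ c) by exists c.
  by rewrite comp.2 => -[x _ <-]; exact: component_closed.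
have tA : trivIset setT Sigma_ := enumerated_components_trivIset _ _ _ _ comp.
have coverE : \bigcup_c Sigma_ c = Sigma := enumerated_components_cover _ _ _ _ comp.
(* [0 < tau < p] forces [p] to be positive, so the truncated subtraction [d - m] is genuine and
   [beta] is a true quotient. *)
have p0 : 0 < p%:R :> R by exact: lt_trans taup.
have beta1 : beta < 1 by rewrite ltr_pdivrMr// mul1r.
have beta0 : 0 < beta by rewrite divr_gt0.
rewrite -coverE in Sigma_fin.
have := KL_mean_field _ _ _ mu _ _ _ _ mA tA Sigma_fin mu_gt0 beta0 beta1
  alpha0_gt0 alpha0_1.
by rewrite coverE.
Qed.
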